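(* For every integer $m\geq 2$, the sequence $\{i(i+1)\left(d_i^{2}(m)-d_{i-1}(m)d_{i+1}(m)\right)\}_{1\leq i \leq m}$ is log-concave.
   Context: For integers $m\ge 0$ and $0\le i\le m$, the Boros-Moll numbers are $$d_i(m)=2^{-2m}\sum_{k=i}^m 2^k\binom{2m-2k}{m-k}\binom{m+k}{k}\binom{k}{i},$$ with the convention $d_i(m)=0$ for $i<0$ or $i>m$. The notation $d_i^{2}(m)$ means $(d_i(m))^2$. A finite real sequence is log-concave if each term squared is at least the product of its two neighbouring terms, where terms outside the index range are taken to be $0$. *)

(* Defs.v *)
From mathcomp Require Import all_boot all_order all_algebra.

Set Implicit Arguments.
Unset Strict Implicit.
Unset Printing Implicit Defensive.

Import Order.TTheory GRing.Theory Num.Theory.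
Local Open Scope ring_scope.

(* The sum is empty when m < i, which gives the convention d_i(m) = 0 there.
   The truncated subtractions are exact since k <= m in the sum. *)
Definition boros_moll (R : realFieldType) (m i : nat) : R :=
  2 ^- (2 * m) *
  \sum_(i <= k < m.+1)
    2 ^+ k * 'C(2 * m - 2 * k, m - k)%:R * 'C(m + k, k)%:R * 'C(k, i)%:R.

(* For i < size s, the item (0 :: s)`_i is the left neighbour of s`_i (0 when
   i = 0) and s`_i.+1 is its right neighbour (0 when i is the last index). *)
Definition log_concave (R : realFieldType) (s : seq R) : Prop :=
  forall i : nat, (i < size s)%N -> (0 :: s)`_i * s`_i.+1 <= s`_i ^+ 2.

(* The index i starts at 1, so i.-1 is the true predecessor. *)
Definition weighted_boros_moll_seq (R : realFieldType) (m : nat) : seq R :=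
  [seq i%:R * i.+1%:R *
       (boros_moll R m i ^+ 2 - boros_moll R m i.-1 * boros_moll R m i.+1)
  | i <- index_iota 1 m.+1].

(* Main.v *)
(* For fixed m the numbers d_i satisfy a three-term recurrence in i (Zeilberger),
   so the inequality for three consecutive weighted terms becomes the positivity
   of a quartic form in (d_{i-1}, d_i).  The recurrence with d_{m+1} = 0, run
   downwards from i = m + 1, gives
     2 (m + 1 - i) / (2 i + 1) <= d_i / d_{i-1} <= (m + 1 - i) / i,
   and once this interval is parametrized by a pair of nonnegative numbers, the
   quartic form has only nonnegative coefficients. *)
Require Import Defs.
From mathcomp Require Import all_boot all_order all_algebra.
From mathcomp Require Import ring lra zify.

Set Implicit Arguments.
Unset Strict Implicit.
Unset Printing Implicit Defensive.

Import Order.TTheory GRing.Theory Num.Theory.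
Local Open Scope ring_scope.

(** * Central binomial coefficients, and inequalities for an abstract three-term recurrence *)

Lemma central_binomial_rec (n : nat) :
  (n.+1 * 'C(2 * n.+1, n.+1) = 2 * (2 * n).+1 * 'C(2 * n, n))%N.
Proof.
have h1 := mul_bin_diag (2 * n).+2 n.
have h2 := mul_bin_down (2 * n).+1 n.
have -> : (2 * n.+1 = (2 * n).+2)%N by lia.
rewrite -h1 /=.
have e : ((2 * n).+1 - n = n.+1)%N by lia.
rewrite e /= in h2.
nia.
Qed.

(* Syntactic matching keeps unification from unfolding large numerals. *)
Ltac nonneg_poly :=
  repeat match goal with
  | |- is_true (0 <= _ + _) => apply: addr_ge0
  | |- is_true (0 <= _ * _) => apply: mulr_ge0
  | |- is_true (0 <= _ ^+ _) => apply: exprn_ge0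
  | |- is_true (0 <= _%:R) => exact: ler0n
  end; try assumption.

(* With [X = p * d_{i-1}] and [Y = i * d_i], where [i = k + 1] and
   [p = m + 1 - i], the ratio bounds say exactly that [u] and [h] are
   nonnegative; [e] is [i * (i + 1) * d_{i+1}]. *)
Lemma three_term_quartic_ge0 (R : realFieldType) (k p u h m X Y e : R) :
    0 <= k -> 0 <= p -> 0 <= u -> 0 <= h ->
    m = p + k -> Y = 2 * (k + 1) * u + h -> X = Y + u ->
    e = (2 * m + 1) * Y - (m + k + 1) * X ->
  k * ((p + 1) * (m + k) * (k + 1) * X ^+ 2
       - k * p * Y * ((2 * m + 1) * X - p * Y))
    * ((k + 3) * e ^+ 2
       - (k + 2) * Y * ((2 * m + 1) * e - (p - 1) * (m + k + 2) * Y))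
  <= (p + 1) * (m + k) * (k + 2)
     * ((k + 2) * p * Y ^+ 2 - (k + 1) * X * e) ^+ 2.
Proof.
move=> k0 p0 u0 h0 -> eY eX ->; rewrite -subr_ge0 eX eY.
set L := (_ - _).
have -> : L =
   ((32 * k ^+ 4 + 152 * k ^+ 3 + 248 * k ^+ 2 + 178 * k + 50) * p ^+ 4
     + (160 * k ^+ 5 + 736 * k ^+ 4 + 1328 * k ^+ 3 + 1224 * k ^+ 2 +
        582 * k + 110) * p ^+ 3
     + (240 * k ^+ 6 + 1296 * k ^+ 5 + 2932 * k ^+ 4 + 3544 * k ^+ 3 +
        2336 * k ^+ 2 + 746 * k + 78) * p ^+ 2
     + (176 * k ^+ 7 + 1136 * k ^+ 6 + 3124 * k ^+ 5 + 4668 * k ^+ 4 +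
        3972 * k ^+ 3 + 1828 * k ^+ 2 + 378 * k + 18) * p
     + (64 * k ^+ 8 + 496 * k ^+ 7 + 1632 * k ^+ 6 + 2908 * k ^+ 5 +
        2960 * k ^+ 4 + 1660 * k ^+ 3 + 444 * k ^+ 2 + 36 * k))
    * (u ^+ 4)
  + ((64 * k ^+ 3 + 216 * k ^+ 2 + 228 * k + 80) * p ^+ 4
     + (272 * k ^+ 4 + 952 * k ^+ 3 + 1228 * k ^+ 2 + 706 * k + 148) *
        p ^+ 3
     + (416 * k ^+ 5 + 1812 * k ^+ 4 + 3104 * k ^+ 3 + 2516 * k ^+ 2 +
        880 * k + 80) * p ^+ 2
     + (32 * k ^+ 7 + 512 * k ^+ 6 + 2148 * k ^+ 5 + 4138 * k ^+ 4 +
        4130 * k ^+ 3 + 2072 * k ^+ 2 + 426 * k + 12) * p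
     + (32 * k ^+ 8 + 352 * k ^+ 7 + 1456 * k ^+ 6 + 3048 * k ^+ 5 +
        3470 * k ^+ 4 + 2066 * k ^+ 3 + 532 * k ^+ 2 + 24 * k))
    * (u ^+ 3 * h)
  + ((48 * k ^+ 2 + 102 * k + 52) * p ^+ 4
     + (168 * k ^+ 3 + 408 * k ^+ 2 + 322 * k + 80) * p ^+ 3
     + (260 * k ^+ 4 + 862 * k ^+ 3 + 997 * k ^+ 2 + 418 * k + 30) * p
        ^+ 2
     + (48 * k ^+ 6 + 436 * k ^+ 5 + 1258 * k ^+ 4 + 1612 * k ^+ 3 +
        939 * k ^+ 2 + 202 * k + 2) * p
     + (48 * k ^+ 7 + 368 * k ^+ 6 + 1080 * k ^+ 5 + 1532 * k ^+ 4 +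
        1052 * k ^+ 3 + 284 * k ^+ 2 + 4 * k))
    * (u ^+ 2 * h ^+ 2)
  + ((16 * k + 16) * p ^+ 4
     + (44 * k ^+ 2 + 62 * k + 20) * p ^+ 3
     + (68 * k ^+ 3 + 156 * k ^+ 2 + 92 * k + 4) * p ^+ 2
     + (24 * k ^+ 5 + 140 * k ^+ 4 + 262 * k ^+ 3 + 191 * k ^+ 2 + 46 *
        k) * p
     + (24 * k ^+ 6 + 136 * k ^+ 5 + 278 * k ^+ 4 + 242 * k ^+ 3 + 76 *
        k ^+ 2))
    * (u * h ^+ 3)
  + (2 * p ^+ 4
     + (4 * k + 2) * p ^+ 3
     + (6 * k ^+ 2 + 8 * k) * p ^+ 2
     + (4 * k ^+ 4 + 14 * k ^+ 3 + 14 * k ^+ 2 + 4 * k) * p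
     + (4 * k ^+ 5 + 16 * k ^+ 4 + 20 * k ^+ 3 + 8 * k ^+ 2))
    * (h ^+ 4).
  by rewrite /L; ring.
by nonneg_poly.
Qed.

(** Here [z], [x], [y], [t], [v] stand for d_{k-1}, ..., d_{k+3}. The recurrences express [z], [t],
    [v] through [x] and [y], so clearing denominators reduces the claim to
    [three_term_quartic_ge0]. *)
Lemma three_term_log_concave (R : realFieldType) (k p z x y t v : R) :
    0 <= k -> 0 < p -> (k + 1) * y <= p * x -> 2 * p * x <= (2 * k + 3) * y ->
    let m := p + k in
    k * (k + 1) * y = k * (2 * m + 1) * x - (p + 1) * (m + k) * z ->
    (k + 1) * (k + 2) * t = (k + 1) * (2 * m + 1) * y - p * (m + k + 1) * x ->
    (k + 2) * (k + 3) * v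
      = (k + 2) * (2 * m + 1) * t - (p - 1) * (m + k + 2) * y ->
  k * (k + 1) * (x ^+ 2 - z * y) * ((k + 2) * (k + 3) * (t ^+ 2 - y * v))
    <= ((k + 1) * (k + 2) * (y ^+ 2 - x * t)) ^+ 2.
Proof.
move=> k0 p0 ub lb m hz ht hv.
have m0 : 0 < m + k by rewrite /m; lra.
pose X := p * x; pose Y := (k + 1) * y.
(* [u] is the slack in [ub]; [h] is [k + 1] times the slack in [lb], scaled so that
   [Y = 2 * (k + 1) * u + h]. *)
pose u := X - Y; pose h := (k + 1) * ((2 * k + 3) * y - 2 * p * x).
have u0 : 0 <= u by rewrite subr_ge0.
have h0 : 0 <= h by rewrite mulr_ge0 ?subr_ge0 //; lra.
have eY : Y = 2 * (k + 1) * u + h by rewrite /h /u /X /Y; ring.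
have eX : X = Y + u by rewrite /u; ring.
have := three_term_quartic_ge0 k0 (ltW p0) u0 h0 (erefl m) eY eX (erefl _).
set e := _ - (m + k + 1) * X; set C := (p + 1) * (m + k).
set Wm := _ - k * p * Y * _; set Wp := (k + 3) * _ - _; set W0 := _ - _ * e.
have et : e = (k + 1) * ((k + 2) * t).
  by rewrite mulrA ht /e /X /Y; ring.
(* The factor [C] is the coefficient of [z] in [hz]; [p ^+ 2] turns [x ^+ 2] into [X ^+ 2]. *)
have eWm : p ^+ 2 * C * (k * (k + 1) * (x ^+ 2 - z * y)) = k * Wm.
  transitivity (p ^+ 2 * k * (k + 1) * (C * x ^+ 2 - C * z * y)); first by ring.
  have -> : C * z = k * (2 * m + 1) * x - k * (k + 1) * y by rewrite hz /C; ring.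
  by rewrite /Wm /X /Y; ring.
have eW0 : (k + 1) * p * ((k + 1) * (k + 2) * (y ^+ 2 - x * t)) = W0.
  by rewrite /W0 et /X /Y; ring.
have eWp : (k + 1) ^+ 2 * (k + 2) * ((k + 2) * (k + 3) * (t ^+ 2 - y * v)) = Wp.
  transitivity ((k + 1) ^+ 2 * (k + 2)
    * ((k + 2) * (k + 3) * t ^+ 2 - y * ((k + 2) * (k + 3) * v))).
    by ring.
  by rewrite hv /Wp et /Y; ring.
rewrite -eWm -eW0 -eWp => le_w.
(* The scalings of [Wm] and [Wp] multiply to [C * (k + 2)] times the square of the scaling of [W0],
   so one positive factor cancels from both sides. *)
have pos : 0 < p ^+ 2 * C * ((k + 1) ^+ 2 * (k + 2)).
  by rewrite !mulr_gt0 ?exprn_gt0 //; lra.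
rewrite -(ler_pM2l pos).
set a := k * (k + 1) * _ in le_w *; set b := (k + 2) * _ * _ in le_w *.
rewrite (_ : _ * (a * b) = p ^+ 2 * C * a * ((k + 1) ^+ 2 * (k + 2) * b));
  last by ring.
apply: (le_trans le_w); rewrite le_eqVlt; apply/orP; left; apply/eqP.
by rewrite /C; ring.
Qed.

(** By the recurrence, [y / x] increases with [z / y], so a lower bound on one ratio yields a lower
    bound on the other, and likewise for upper bounds. *)
Lemma ratio_bounds_step (R : realFieldType) (k n x y z : R) :
    0 <= k -> 0 <= n -> 0 <= x ->
    let m := n + k + 1 in
    (k + 1) * (k + 2) * z
      = (k + 1) * (2 * m + 1) * y - (n + 1) * (m + k + 1) * x ->
    2 * n * y <= (2 * k + 5) * z -> (k + 2) * z <= n * y ->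
  2 * (n + 1) * x <= (2 * k + 3) * y /\ (k + 1) * y <= (n + 1) * x.
Proof.
move=> k0 n0 x0 m hz lb ub.
have mE : m = n + k + 1 by [].
have k1 : 0 <= k + 1 by lra.
have nx : 0 <= (n + 1) * x by rewrite mulr_ge0 //; lra.
have ub' := ler_wpM2l k1 ub.
have E : (k + 1) * ((k + 2) * z)
    = (k + 1) * (2 * m + 1) * y - (n + 1) * (m + k + 1) * x by rewrite mulrA.
split.
  (* [(k + 1) * K] is the coefficient of [y] once [z] is replaced by its lower bound in the
     recurrence scaled by [2 * k + 5]. *)
  pose K := (2 * k + 5) * (2 * m + 1) - 2 * (k + 2) * n.
  have K0 : 0 < (k + 1) * K.
    have -> : K = 2 * k * n + 6 * n + 4 * k ^+ 2 + 16 * k + 15.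
      by rewrite /K mE; ring.
    apply: mulr_gt0; first lra.
    by rewrite ltr_wpDl // !addr_ge0 ?mulr_ge0 ?exprn_ge0.
  rewrite -(ler_pM2l K0).
  have le1 : (2 * k + 5) * ((n + 1) * (m + k + 1) * x) <= (k + 1) * K * y.
    rewrite -subr_ge0.
    rewrite (_ : _ - _ = (k + 1) * ((k + 2) * ((2 * k + 5) * z - 2 * n * y))).
      by rewrite !mulr_ge0 ?subr_ge0 //; lra.
    transitivity ((2 * k + 5) * ((k + 1) * ((k + 2) * z))
      - (k + 1) * ((k + 2) * (2 * n * y))); last by ring.
    by rewrite E /K; ring.
  have k3 : 0 <= 2 * k + 3 by lra.
  apply: (@le_trans _ _ ((2 * k + 3) * ((k + 1) * K * y))); last first.
    by rewrite le_eqVlt; apply/orP; left; apply/eqP; ring.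
  apply: le_trans (ler_wpM2l k3 le1); rewrite -subr_ge0.
  rewrite (_ : _ - _ = 3 * n * ((n + 1) * x)).
    by rewrite mulr_ge0 // mulr_ge0.
  by rewrite /K mE; ring.
(* Inserting the upper bound on [z] leaves [2 * m + 1 - n = m + k + 2] as a factor of [y]; the slack
   is [(n + 1) * x]. *)
have M0 : 0 < m + k + 2 by rewrite mE; lra.
rewrite -(ler_pM2l M0).
move: ub'; rewrite E => ub'.
have -> : (m + k + 2) * ((n + 1) * x)
  = (n + 1) * (m + k + 1) * x + (n + 1) * x by ring.
have -> : (m + k + 2) * ((k + 1) * y)
  = (k + 1) * (2 * m + 1) * y - (k + 1) * (n * y) by rewrite mE; ring.
lra.
Qed.

(** * Recurrence and ratio bounds for the Boros-Moll numbers *)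

Section BorosMoll.
Variables (R : realFieldType) (m : nat).

Definition boros_moll_weight (k : nat) : R :=
  2 ^+ k * 'C(2 * m - 2 * k, m - k)%:R * 'C(m + k, k)%:R.

Local Notation c := boros_moll_weight.
Local Notation d := (boros_moll R m).

(** Terms with [k < i] vanish; a range free of [i] lets sums for different [i] be combined
    termwise. *)
Lemma boros_mollE (i : nat) :
  d i = 2 ^- (2 * m) * \sum_(k < m.+1) c k * 'C(k, i)%:R.
Proof.
rewrite /boros_moll; congr (_ * _).
rewrite -(big_mkord xpredT (fun k => c k * 'C(k, i)%:R)).
have [le_im | lt_mi] := leqP i m.+1.
  rewrite [RHS](@big_cat_nat _ _ _ i) //=.
  have -> : \sum_(0 <= k < i) c k * 'C(k, i)%:R = 0; last by rewrite add0r.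
  rewrite big_nat big1 // => k /andP[_ lt_ki].
  by rewrite bin_small ?mulr0.
rewrite [LHS]big_geq 1?ltnW // [RHS]big_nat big1 // => k /andP[_ lt_km].
by rewrite bin_small ?mulr0 // (ltn_trans lt_km).
Qed.

Lemma boros_moll_ge0 (i : nat) : 0 <= d i.
Proof.
rewrite boros_mollE mulr_ge0 ?invr_ge0 ?exprn_ge0 //.
by apply: sumr_ge0 => k _; rewrite /c !mulr_ge0 ?exprn_ge0.
Qed.

Lemma boros_moll_small (i : nat) : (m < i)%N -> d i = 0.
Proof. by move=> lt_mi; rewrite /boros_moll big_geq ?mulr0. Qed.

Lemma boros_moll_weight_rec (k : nat) : (k < m)%N ->
  c k.+1 * k.+1%:R * (2 * m%:R - 2 * k%:R - 1)
    = c k * (m%:R - k%:R) * (m%:R + k%:R + 1).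
Proof.
move=> lt_km; pose n := (m - k.+1)%N.
have em : m = (n + k.+1)%N by rewrite subnK.
have mR : m%:R = n%:R + k%:R + 1 :> R by rewrite em addnS -natr1 natrD.
rewrite /c.
have -> : (2 * m - 2 * k = 2 * n.+1)%N by lia.
have -> : (2 * m - 2 * k.+1 = 2 * n)%N by lia.
have -> : (m - k = n.+1)%N by lia.
have -> : (m - k.+1 = n)%N by [].
have h1 := congr1 (fun x : nat => x%:R : R) (central_binomial_rec n).
have h2 := congr1 (fun x : nat => x%:R : R) (mul_bin_diag (m + k).+1 k).
rewrite !natrM /= in h1 h2; rewrite addnS.
have -> : 2 * m%:R - 2 * k%:R - 1 = ((2 * n).+1)%:R :> R.
  by rewrite -(natr1 (2 * n)) natrM mR; ring.
have -> : m%:R - k%:R = n.+1%:R :> R by rewrite mR -(natr1 n); ring.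
have -> : m%:R + k%:R + 1 = (m + k).+1%:R :> R by rewrite -natr1 natrD.
rewrite exprS.
transitivity (2 ^+ k * (2 * (2 * n).+1%:R * 'C(2 * n, n)%:R)
  * (k.+1%:R * 'C((m + k).+1, k.+1)%:R) : R); first by ring.
by rewrite -h1 -h2; ring.
Qed.

(* Zeilberger telescoping: by absorption of binomial coefficients, the
   difference of the two summands is the [k]-th summand of [boros_moll_rec]. *)
Lemma boros_moll_telescope (i : nat) :
  \sum_(k < m.+1) c k * (m%:R - k%:R) * (m%:R + k%:R + 1) * 'C(k, i)%:R
  = \sum_(k < m.+1) c k * (2 * m%:R - 2 * k%:R + 1) * i.+1%:R * 'C(k, i.+1)%:R.
Proof.
(* The left term at [k = m] and the right term at [k = 0] vanish; the rest match after a shift by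
   one. *)
rewrite big_ord_recr /= subrr mulr0 !mul0r addr0.
rewrite [RHS]big_ord_recl /= bin0n mulr0 add0r.
apply: eq_bigr => k _; rewrite -boros_moll_weight_rec //.
have h := congr1 (fun x : nat => x%:R : R) (mul_bin_diag k.+1 i).
rewrite !natrM /= in h.
rewrite /bump /= add1n -[RHS]mulrA -h -natr1; ring.
Qed.

Lemma boros_moll_rec (i : nat) :
  i.+1%:R * i.+2%:R * d i.+2
  = i.+1%:R * (2 * m%:R + 1) * d i.+1 - (m%:R - i%:R) * (m%:R + i%:R + 1) * d i.
Proof.
rewrite !boros_mollE.
apply/eqP; rewrite -subr_eq0; apply/eqP.
transitivity (2 ^- (2 * m) *
  ((\sum_(k < m.+1) c k * (m%:R - k%:R) * (m%:R + k%:R + 1) * 'C(k, i)%:R)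
  - \sum_(k < m.+1) c k * (2 * m%:R - 2 * k%:R + 1) * i.+1%:R * 'C(k, i.+1)%:R)
  : R); last by rewrite boros_moll_telescope subrr mulr0.
rewrite mulrBr !mulr_sumr -!sumrB /=.
apply: eq_bigr => k _ /=.
have h1 := congr1 (fun x : nat => x%:R : R) (mul_bin_left k i).
have h2 := congr1 (fun x : nat => x%:R : R) (mul_bin_left k i.+1).
(* Where the natural subtraction truncates, the binomial coefficient is zero. *)
have sub_bin j : (k - j)%:R * 'C(k, j)%:R = (k%:R - j%:R) * 'C(k, j)%:R :> R.
  have [le_jk | lt_kj] := leqP j k; first by rewrite natrB.
  by rewrite bin_small // !mulr0.
rewrite !natrM !sub_bin in h1 h2.
set q := 2 ^- _; set C0 := 'C(k, i)%:R in h1 *.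
set C1 := 'C(k, i.+1)%:R in h1 h2 *; set C2 := 'C(k, i.+2)%:R in h2 *.
apply/eqP; rewrite -subr_eq0; apply/eqP.
(* The summand is a combination of the two absorption identities [h1] and [h2]. *)
transitivity (q * c k *
  (i.+1%:R * (i.+2%:R * C2 - (k%:R - i.+1%:R) * C1)
   - (k%:R + i%:R + 1) * (i.+1%:R * C1 - (k%:R - i%:R) * C0))).
  by rewrite -!natr1; ring.
by rewrite h1 h2 !subrr !mulr0 subrr mulr0.
Qed.

Lemma boros_moll_ratio_bounds (i : nat) : (i <= m)%N ->
  2 * (m%:R - i%:R) * d i <= (2 * i%:R + 3) * d i.+1
  /\ (i%:R + 1) * d i.+1 <= (m%:R - i%:R) * d i.
Proof.
(* Downward induction on the index, via [m - i]. At [i = m] both inequalities read 0 <= 0, since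
   d_{m+1} = 0. *)
move=> le_im; rewrite -(subKn le_im); have := leq_subr i m.
elim: (m - i)%N => [_|n IHn lt_nm].
  by rewrite subn0 (boros_moll_small (ltnSn m)) !subrr !(mulr0, mul0r).
have [lb ub] := IHn (ltnW lt_nm).
have e : (m - n = (m - n.+1).+1)%N by lia.
rewrite e in lb ub; set k := (m - n.+1)%N in lb ub *.
have mE : m%:R = n%:R + k%:R + 1 :> R.
  by rewrite -natrD natr1; congr (_%:R); lia.
have -> : m%:R - k%:R = n%:R + 1 :> R by rewrite mE; ring.
have nE : m%:R - k.+1%:R = n%:R :> R by rewrite -natr1 mE; ring.
rewrite nE in lb ub.
apply: (@ratio_bounds_step _ _ _ _ _ (d k.+2)) => //.
- exact: boros_moll_ge0.
- rewrite -mE; have := boros_moll_rec k.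
  rewrite -(natr1 k.+1) -(natr1 k) => h.
  have -> : k%:R + 2 = k%:R + 1 + 1 :> R by ring.
  by rewrite h mE; ring.
- by apply: le_trans lb _; rewrite -natr1; lra.
- by apply: le_trans ub; rewrite -natr1; lra.
Qed.

(** * Log-concavity of the weighted terms *)

Definition weighted_boros_moll (i : nat) : R :=
  i%:R * i.+1%:R * (d i ^+ 2 - d i.-1 * d i.+1).

Local Notation w := weighted_boros_moll.

Lemma weighted_boros_moll_log_concave (i : nat) : (i < m)%N ->
  w i * w i.+2 <= w i.+1 ^+ 2.
Proof.
case: i => [_|k lt_km].
  by rewrite /w !mul0r sqr_ge0.
have [lb ub] := boros_moll_ratio_bounds (ltnW lt_km).
have rec0 := boros_moll_rec k.
have rec1 := boros_moll_rec k.+1.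
have rec2 := boros_moll_rec k.+2.
have p0 : 0 < m%:R - k.+1%:R :> R by rewrite subr_gt0 ltr_nat.
have natS j : j.+1%:R = j%:R + 1 :> R by rewrite natr1.
rewrite /w /= !(natS k.+3) !(natS k.+2) !(natS k.+1).
rewrite !(natS k.+3) !(natS k.+2) !(natS k.+1) in rec0 rec1 rec2.
(* Everything is rewritten in [K], the index of the left weighted term, and [p = m - K]. *)
have kE : k%:R = k.+1%:R - 1 :> R by rewrite natS addrK.
rewrite {}kE in rec0.
move: (k.+1%:R : R) (ler0n R k.+1) p0 lb ub rec0 rec1 rec2 => K K0 p0 lb ub.
set p := m%:R - K in p0 lb ub *.
have -> : m%:R = p + K by rewrite /p subrK.
move=> rec0 rec1 rec2.
have := @three_term_log_concave _ K p (d k) (d k.+1) (d k.+2) (d k.+3) (d k.+4).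
rewrite (_ : K + 1 + 1 = K + 2); last by ring.
rewrite (_ : K + 2 + 1 = K + 3); last by ring.
apply => //.
- by rewrite rec0; ring.
- have -> : K + 2 = K + 1 + 1 by ring.
  by rewrite rec1; ring.
- have -> : K + 2 = K + 1 + 1 by ring.
  have -> : K + 3 = K + 1 + 1 + 1 by ring.
  by rewrite rec2; ring.
Qed.

End BorosMoll.

Theorem theorem1p7 (R : realFieldType) (m : nat) (hm : (2 <= m)%N) :
  log_concave (weighted_boros_moll_seq R m).
Proof.
move=> i; rewrite size_map size_iota subn1 /= => lt_im.
have nthE j : (j <= m)%N -> (weighted_boros_moll_seq R m)`_j =
    weighted_boros_moll R m j.+1.
  rewrite leq_eqVlt => /predU1P[-> | lt_jm].
    (* At [j = m] the default 0 past the end agrees with the weighted term at [m + 1], as d_{m+1} =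
       d_{m+2} = 0. *)
    rewrite nth_default ?size_map ?size_iota ?subn1 //.
    rewrite /weighted_boros_moll (boros_moll_small _ (ltnSn m)).
    by rewrite (boros_moll_small _ (leqnSn m.+1)) expr0n mulr0 subrr mulr0.
  by rewrite (nth_map 0%N) ?size_iota ?subn1 // nth_iota ?subn1.
rewrite !nthE ?(ltnW lt_im) //.
have := weighted_boros_moll_log_concave R lt_im.
case: i lt_im => [|i] lt_im /=; first by rewrite mul0r sqr_ge0.
by rewrite nthE // ltnW // ltnW.
Qed.
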